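(* The algebra $\tilde{\mathcal{A}}_{conv.}$ is left and right noetherian. Moreover, every normal left ideal and every normal right ideal of $\tilde{\mathcal{A}}_{conv.}$ is principal.
   Context: Let $\mathcal{A}_0$ be the $\mathbb{C}$-algebra of polynomials in $a,b$ subject to $ab-ba=b^2$, and $\widehat{\mathcal{A}}$ its completion for the $(a,b)$-adic topology (formal power series $\sum_{p,q\ge0}\gamma_{p,q}a^pb^q$). $\tilde{\mathcal{A}}_{conv.}\subset\widehat{\mathcal{A}}$ is the subalgebra of series for which there exist $R>1$, $C_R>0$ with $|\gamma_{p,q}|\le C_RR^{p+q}q!$ for all $p,q$. A left ideal $I\subset\tilde{\mathcal{A}}_{conv.}$ is called normal if $bx\in I$ implies $x\in I$; a right ideal $I$ is called normal if $xb\in I$ implies $x\in I$. *)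

(* Defs.v *)
From Stdlib Require Import Reals Arith.
From Coquelicot Require Import Coquelicot.
Open Scope R_scope.

(** A formal power series  sum_{p,q} gamma_{p,q} a^p b^q  in the completion
    of A0 = C<a,b>/(ab - ba - b^2), written in the PBW basis a^p b^q. *)
Definition ser := nat -> nat -> C.

(** Normal ordering constants:  b^q a^p = sum_{i,j} nord q p i j a^i b^j.
    Computed from  b^j a = a b^j - j b^(j+1)  (which follows from [a,b]=b^2). *)
Fixpoint nord (q p i j : nat) : R :=
  match p with
  | O => if (Nat.eqb i 0 && Nat.eqb j q)%bool then 1 else 0
  | S p' =>
      (match i with O => 0 | S i' => nord q p' i' j end)
      - (match j with O => 0 | S j' => INR j' * nord q p' i j' end)
  end.

Definition ser0 : ser := fun _ _ => RtoC 0.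
Definition ser_add (f g : ser) : ser := fun p q => Cplus (f p q) (g p q).

(** Product: (sum f_{p,q} a^p b^q)(sum g_{r,s} a^r b^s)
      = sum f_{p,q} g_{r,s} a^p (b^q a^r) b^s ; coefficient of a^m b^n.
    Here i = m - p, j = q + r - i, s = n - j (all finite sums by homogeneity). *)
Definition ser_mul (f g : ser) : ser := fun m n =>
  sum_n (fun p => sum_n (fun q => sum_n (fun r =>
    let i := (m - p)%nat in
    let j := (q + r - i)%nat in
    if (Nat.leb i (q + r) && Nat.leb j n)%bool then
      Cmult (Cmult (f p q) (g r (n - j)%nat)) (RtoC (nord q r i j))
    else RtoC 0) (m + n)) n) m.

Definition ser_b : ser := fun p q =>
  if (Nat.eqb p 0 && Nat.eqb q 1)%bool then RtoC 1 else RtoC 0.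

Definition conv (f : ser) : Prop :=
  exists Rr : R, 1 < Rr /\ exists CR : R, 0 < CR /\
    forall p q : nat, Cmod (f p q) <= CR * Rr ^ (p + q) * INR (fact q).

Definition left_ideal (I : ser -> Prop) : Prop :=
  (forall x, I x -> conv x) /\ I ser0 /\
  (forall x y, I x -> I y -> I (ser_add x y)) /\
  (forall r x, conv r -> I x -> I (ser_mul r x)).

Definition right_ideal (I : ser -> Prop) : Prop :=
  (forall x, I x -> conv x) /\ I ser0 /\
  (forall x y, I x -> I y -> I (ser_add x y)) /\
  (forall r x, conv r -> I x -> I (ser_mul x r)).

Definition left_noetherian : Prop :=
  forall I : nat -> ser -> Prop,
    (forall n, left_ideal (I n)) ->
    (forall n x, I n x -> I (S n) x) ->
    exists N, forall n, (N <= n)%nat -> forall x, I n x -> I N x.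

Definition right_noetherian : Prop :=
  forall I : nat -> ser -> Prop,
    (forall n, right_ideal (I n)) ->
    (forall n x, I n x -> I (S n) x) ->
    exists N, forall n, (N <= n)%nat -> forall x, I n x -> I N x.

Definition normal_left (I : ser -> Prop) : Prop :=
  forall x, conv x -> I (ser_mul ser_b x) -> I x.
Definition normal_right (I : ser -> Prop) : Prop :=
  forall x, conv x -> I (ser_mul x ser_b) -> I x.

Definition principal_left (I : ser -> Prop) : Prop :=
  exists g, conv g /\ forall x, I x <-> exists y, conv y /\ x = ser_mul y g.
Definition principal_right (I : ser -> Prop) : Prop :=
  exists g, conv g /\ forall x, I x <-> exists y, conv y /\ x = ser_mul g y.

(* Main.v *)
Require Import Defs.
From Stdlib Require Import Reals Arith Lra Lia FunctionalExtensionality Classical.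
From Coquelicot Require Import Coquelicot.
Open Scope R_scope.

(** In normal form a series is  x = sum_j x_j(a) b^j,  and b is a normal element:
    b^-1 x b = x + x' b, where x' is the derivative in a.  The key is a
    Weierstrass division: if g_0 has order P at a = 0, then every f is
    g q + r (and q' g + r') with remainder of degree < P in a.  The quotient is
    found coefficient by coefficient, and its convergence is a fixed-point bound
    for the weights A^r B^s (r+2s)!/(r+s)!.

    For an ideal I put I_j = {x : x b^j in I} (b^j x on the left).  Dividing by an
    element of least order among all I_j leaves no remainder; for a normal ideal,
    where I_j = I, this gives a generator.  For an ascending chain it shows that the
    J-th quotients stabilize for some J, and one goes down from J to 0: the
    remainder of a division by an element of least order in I_j is divisible by b,
    so it is governed by I_(j+1). *)

(** * Finite and triangular sums *)

Definition csum (n : nat) (F : nat -> C) : C := sum_n F n.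

Lemma csum_0 F : csum 0 F = F 0%nat.
Proof. exact (sum_O F). Qed.

Lemma csum_S n F : csum (S n) F = (csum n F + F (S n))%C.
Proof. exact (sum_Sn F n). Qed.

Lemma csum_ext n F G : (forall i, (i <= n)%nat -> F i = G i) -> csum n F = csum n G.
Proof. exact (sum_n_ext_loc F G n). Qed.

Lemma csum_zero n F : (forall i, (i <= n)%nat -> F i = RtoC 0) -> csum n F = RtoC 0.
Proof.
  induction n as [|n IH]; intros H.
  - rewrite csum_0. auto.
  - rewrite csum_S, IH, H by auto. ring.
Qed.

Lemma csum_plus n F G : csum n (fun i => (F i + G i)%C) = (csum n F + csum n G)%C.
Proof. exact (sum_n_plus F G n). Qed.

Lemma csum_scal n c F : csum n (fun i => (c * F i)%C) = (c * csum n F)%C.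
Proof. exact (sum_n_mult_l (K := C_Ring) c F n). Qed.

Lemma csum_S_first n F : csum (S n) F = (F 0%nat + csum n (fun i => F (S i)))%C.
Proof.
  induction n as [|n IH].
  - now rewrite csum_S, !csum_0.
  - rewrite csum_S, IH, (csum_S n (fun i => F (S i))). ring.
Qed.

Lemma csum_rev n F : csum n F = csum n (fun i => F (n - i)%nat).
Proof.
  revert F; induction n as [|n IH]; intros F; [now rewrite !csum_0|].
  rewrite csum_S_first, IH, csum_S, Nat.sub_diag.
  rewrite (csum_ext n (fun i => F (S (n - i))) (fun i => F (S n - i)%nat)); [ring|].
  intros i Hi. f_equal. lia.
Qed.

Lemma csum_single n j F :
  (j <= n)%nat -> (forall i, (i <= n)%nat -> i <> j -> F i = RtoC 0) -> csum n F = F j.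
Proof.
  induction n as [|n IH]; intros Hj H.
  - rewrite csum_0. f_equal. lia.
  - rewrite csum_S. destruct (Nat.eq_dec j (S n)) as [->|Hn].
    + rewrite csum_zero; [ring|]. intros i Hi. apply H; lia.
    + rewrite IH, (H (S n)); [ring|lia|lia|lia|]. intros i Hi Hne. apply H; lia.
Qed.

(** Serves to cut the sum over [r] in [ser_mul], whose range is generous, down to the exponents that
    contribute. *)
Lemma csum_window N i K F :
  (i + K <= N)%nat -> (forall r, (r < i \/ i + K < r)%nat -> F r = RtoC 0) ->
  csum N F = csum K (fun k => F (i + k)%nat).
Proof.
  intros Hle H.
  assert (Hhead : forall K, (forall r, (r < i)%nat -> F r = RtoC 0) ->
     csum (i + K) F = csum K (fun k => F (i + k)%nat)).
  { clear. intros K H. induction K as [|K IH].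
    - rewrite csum_0, Nat.add_0_r. apply csum_single; [lia|].
      intros j Hj Hne. apply H; lia.
    - rewrite Nat.add_succ_r, !csum_S, IH. do 2 f_equal. lia. }
  rewrite <- Hhead by (intros; apply H; lia).
  clear Hhead. induction N as [|N IH].
  - f_equal. lia.
  - destruct (Nat.eq_dec (i + K) (S N)) as [->|Hn]; [reflexivity|].
    rewrite csum_S, IH, (H (S N)) by lia. ring.
Qed.

(** In a product coefficient of b-degree n, k letters b arise from reordering, q come from one
    factor and the remaining n - k - q from the other. *)
Definition tri (n : nat) (F : nat -> nat -> C) : C :=
  csum n (fun k => csum (n - k) (fun q => F k q)).

Lemma tri_ext n F G :
  (forall k q, (k + q <= n)%nat -> F k q = G k q) -> tri n F = tri n G.
Proof.
  intros H. apply csum_ext; intros k Hk. apply csum_ext; intros q Hq. apply H; lia.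
Qed.

Lemma tri_zero n F :
  (forall k q, (k + q <= n)%nat -> F k q = RtoC 0) -> tri n F = RtoC 0.
Proof.
  intros H. apply csum_zero; intros k Hk. apply csum_zero; intros q Hq. apply H; lia.
Qed.

Lemma tri_plus n F G : tri n (fun k q => (F k q + G k q)%C) = (tri n F + tri n G)%C.
Proof.
  unfold tri. rewrite <- csum_plus. apply csum_ext; intros. apply csum_plus.
Qed.

Lemma tri_scal n c F : tri n (fun k q => (c * F k q)%C) = (c * tri n F)%C.
Proof.
  unfold tri. rewrite <- csum_scal. apply csum_ext; intros. apply csum_scal.
Qed.

Lemma tri_S_diag n F :
  tri (S n) F = (tri n F + csum (S n) (fun k => F k (S n - k)%nat))%C.
Proof.
  unfold tri. rewrite !csum_S, Nat.sub_diag, csum_0.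
  rewrite (csum_ext n _ (fun k => (csum (n - k) (fun q => F k q) + F k (S n - k)%nat)%C)).
  - rewrite csum_plus. ring.
  - intros k Hk. rewrite (Nat.sub_succ_l k n) by lia. apply csum_S.
Qed.

Lemma tri_transpose n F : tri n F = tri n (fun k q => F q k).
Proof.
  induction n as [|n IH].
  - unfold tri. now rewrite !csum_0.
  - rewrite !tri_S_diag, IH. f_equal. rewrite csum_rev. apply csum_ext; intros k Hk.
    f_equal. lia.
Qed.

Lemma tri_S_first n F :
  tri (S n) F = (csum (S n) (F 0%nat) + tri n (fun k q => F (S k) q))%C.
Proof. unfold tri at 1. rewrite csum_S_first, Nat.sub_0_r. reflexivity. Qed.

Lemma tri_S_second n F :
  tri (S n) F = (csum (S n) (fun k => F k 0%nat) + tri n (fun k q => F k (S q)))%C.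
Proof.
  rewrite tri_transpose, tri_S_first. f_equal. now rewrite tri_transpose.
Qed.

(** Delaying the first index by one loses only the antidiagonal k + q = n and inserts a zero row.
    This aligns terms that differ by one reordering. *)
Lemma tri_reindex n F :
  (forall k q, (k + q)%nat = n -> F k q = RtoC 0) ->
  tri n (fun k q => match k with O => RtoC 0 | S k' => F k' q end) = tri n F.
Proof.
  intros H. destruct n as [|n].
  - unfold tri. rewrite !csum_0. symmetry. now apply H.
  - rewrite tri_S_first, tri_S_diag.
    rewrite (csum_zero (S n) (fun k => F k (S n - k)%nat)) by (intros; apply H; lia).
    rewrite (csum_zero (S n) (fun _ => RtoC 0)) by reflexivity. apply Cplus_comm.
Qed.

Lemma tri_single n k q F :
  (k + q <= n)%nat ->
  (forall k' q', (k' + q' <= n)%nat -> (k' <> k \/ q' <> q) -> F k' q' = RtoC 0) ->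
  tri n F = F k q.
Proof.
  intros Hle H. unfold tri. rewrite (csum_single n k).
  - apply csum_single; [lia|]. intros; apply H; lia.
  - lia.
  - intros i Hi Hne. apply csum_zero; intros; apply H; lia.
Qed.

(** Exchanges the b-exponents contributed by the left and the right factor. *)
Lemma tri_antidiag n F :
  tri n F = tri n (fun k q => F k (n - k - q)%nat).
Proof. apply csum_ext; intros. apply csum_rev. Qed.

(** * The product in normal form *)

(** The rising factorial x (x+1) ... (x+k-1). Since b^q a = a b^q - q b^(q+1), turning k letters a
    into b one after another produces it at x = q. *)
Fixpoint poch (x : R) (k : nat) : R :=
  match k with O => 1 | S k' => poch x k' * (x + INR k') end.

(** The binomial coefficient of i + k over k, indexed by its two parts so that its recursions
    involve no subtraction. *)
Definition bn (i k : nat) : R := INR (fact (i + k)) / (INR (fact i) * INR (fact k)).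

Lemma fact_S_R n : INR (fact (S n)) = (INR n + 1) * INR (fact n).
Proof. rewrite fact_simpl, mult_INR, S_INR. reflexivity. Qed.

Lemma fact_R_pos n : 0 < INR (fact n).
Proof. apply INR_fact_lt_0. Qed.

Ltac fact_field :=
  unfold bn; rewrite ?Nat.add_succ_r, ?Nat.add_succ_l, ?fact_S_R, ?S_INR, ?plus_INR;
  repeat match goal with
  | |- context [INR (fact ?n)] =>
      lazymatch goal with
      | _ : 0 < INR (fact n) |- _ => fail
      | _ => pose proof (fact_R_pos n) end
  | |- context [INR ?n] =>
      lazymatch n with fact _ => fail | _ =>
      lazymatch goal with
      | _ : 0 <= INR n |- _ => fail
      | _ => pose proof (pos_INR n) end end
  end; field; repeat split; lra.

Lemma bn_0_r i : bn i 0 = 1.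
Proof.
  unfold bn. rewrite Nat.add_0_r. simpl (fact 0). simpl INR at 3.
  pose proof (fact_R_pos i). field. lra.
Qed.

Lemma bn_0_l k : bn 0 k = 1.
Proof.
  unfold bn. rewrite Nat.add_0_l. simpl (fact 0). simpl INR at 2.
  pose proof (fact_R_pos k). field. lra.
Qed.

Lemma bn_pascal i k : bn (S i) (S k) = bn i (S k) + bn (S i) k.
Proof. fact_field. Qed.

Lemma bn_S_l i k : (INR i + 1) * bn (S i) k = (INR i + INR k + 1) * bn i k.
Proof. fact_field. Qed.

Lemma bn_S_r i k : (INR k + 1) * bn i (S k) = (INR i + INR k + 1) * bn i k.
Proof. fact_field. Qed.

Lemma bn_pos i k : 0 < bn i k.
Proof.
  unfold bn. apply Rdiv_lt_0_compat; [apply fact_R_pos|].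
  apply Rmult_lt_0_compat; apply fact_R_pos.
Qed.

Lemma bn_le_pow2 i k : bn i k <= 2 ^ (i + k).
Proof.
  revert k; induction i as [|i IHi]; intros k.
  - rewrite bn_0_l. apply pow_R1_Rle. lra.
  - induction k as [|k IHk].
    + rewrite bn_0_r. apply pow_R1_Rle. lra.
    + rewrite bn_pascal. specialize (IHi (S k)).
      replace (S i + S k)%nat with (S (S i + k)) by lia.
      replace (i + S k)%nat with (S i + k)%nat in IHi by lia.
      simpl pow in *. lra.
Qed.

(* [b^q a^r] is the sum of [kap i k q a^i b^(q+k)] over [i + k = r]. *)
Definition kap (i k q : nat) : R := (-1) ^ k * bn i k * poch (INR q) k.

Lemma poch_0 k : poch 0 (S k) = 0.
Proof.
  induction k as [|k IH]; [simpl; ring|].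
  change (poch 0 (S k) * (0 + INR (S k)) = 0). rewrite IH. ring.
Qed.

Lemma kap_k0 i q : kap i 0 q = 1.
Proof. unfold kap. rewrite bn_0_r. simpl. ring. Qed.

Lemma kap_q0 i k : kap i (S k) 0 = 0.
Proof. unfold kap. change (INR 0) with 0. rewrite poch_0. ring. Qed.

Lemma nord_out q r i j : (r < i)%nat -> nord q r i j = 0.
Proof.
  revert i j; induction r as [|r IH]; intros i j H.
  - destruct i; [lia|]. reflexivity.
  - simpl. destruct i as [|i]; [lia|]. rewrite IH by lia.
    destruct j; [lra|]. rewrite IH by lia. lra.
Qed.

Lemma nord_low q r i j : (j < q)%nat -> nord q r i j = 0.
Proof.
  revert i j; induction r as [|r IH]; intros i j H.
  - simpl. destruct i; [|reflexivity]. simpl. destruct (Nat.eqb_spec j q); [lia|reflexivity].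
  - simpl. destruct i as [|i]; destruct j as [|j]; rewrite ?IH by lia; lra.
Qed.

(** Of the i + k letters a that cross b^q, k turn into b: their choice gives the binomial
    coefficient, and the successive exponents q, q + 1, ... give the signed rising factorial. The
    recursion of [nord] thus becomes Pascal's rule. *)
Lemma nord_kap q i k : nord q (i + k) i (q + k) = kap i k q.
Proof.
  revert i; induction k as [|k IHk]; intros i.
  - rewrite kap_k0, !Nat.add_0_r. induction i as [|i IHi].
    + simpl. now rewrite Nat.eqb_refl.
    + simpl. rewrite IHi. destruct q; [lra|]. rewrite nord_low by lia. lra.
  - assert (Hstep : forall i, INR (q + k) * nord q (i + k) i (q + k)
                 = - ((-1) ^ S k * bn i k * poch (INR q) (S k))).
    { intros j. rewrite IHk. unfold kap. rewrite plus_INR. simpl. ring. }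
    rewrite !Nat.add_succ_r. simpl nord. rewrite Hstep.
    induction i as [|i IHi].
    + unfold kap. rewrite !bn_0_l. ring.
    + rewrite Nat.add_succ_l. simpl nord. rewrite Hstep, IHi.
      unfold kap. rewrite bn_pascal. ring.
Qed.

(** The term a^p b^q of f meets a term of g with m - p + k letters a, of which k turn into b while
    crossing b^q. *)
Definition mul_term (f g : ser) (m n p k q : nat) : C :=
  (RtoC (kap (m - p) k q) * (f p q * g (m - p + k)%nat (n - k - q)%nat))%C.

Lemma ser_mulE f g m n :
  ser_mul f g m n = csum m (fun p => tri n (mul_term f g m n p)).
Proof.
  unfold ser_mul. apply csum_ext; intros p Hp.
  rewrite tri_transpose. apply csum_ext; intros q Hq.
  change (csum (m + n) (fun r =>
     let i := (m - p)%nat in let j := (q + r - i)%nat in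
     if (Nat.leb i (q + r) && Nat.leb j n)%bool
     then (f p q * g r (n - j)%nat * RtoC (nord q r i j))%C else RtoC 0)
   = csum (n - q) (fun k => mul_term f g m n p k q)).
  (* Only m - p <= r <= m - p + (n - q) contributes: below, there are too few letters a; above, the
     b-exponent j exceeds n. *)
  rewrite (csum_window _ (m - p) (n - q)).
  - apply csum_ext; intros k Hk. cbv zeta.
    replace (q + (m - p + k) - (m - p))%nat with (q + k)%nat by lia.
    rewrite nord_kap.
    destruct (Nat.leb_spec (m - p) (q + (m - p + k))); [|lia].
    destruct (Nat.leb_spec (q + k) n); [|lia]. simpl andb. cbv iota.
    unfold mul_term. replace (n - k - q)%nat with (n - (q + k))%nat by lia. ring.
  - lia.
  - intros r Hr. cbv zeta.
    destruct (Nat.leb_spec (m - p) (q + r)); [|reflexivity].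
    destruct (Nat.leb_spec (q + r - (m - p)) n); [|reflexivity].
    simpl andb. cbv iota. rewrite nord_out by lia. ring.
Qed.

Lemma ser_ext (f g : ser) : (forall m n, f m n = g m n) -> f = g.
Proof. intros H. extensionality m. extensionality n. apply H. Qed.

Definition ser_scal (c : C) (f : ser) : ser := fun p q => (c * f p q)%C.
Definition ser_one : ser := fun p q => match p, q with O, O => RtoC 1 | _, _ => RtoC 0 end.

Lemma ser_mul_add_l f g h : ser_mul (ser_add f g) h = ser_add (ser_mul f h) (ser_mul g h).
Proof.
  apply ser_ext; intros m n. unfold ser_add at 2. rewrite !ser_mulE, <- csum_plus.
  apply csum_ext; intros p Hp. rewrite <- tri_plus. apply tri_ext; intros k q H.
  unfold mul_term, ser_add. ring.
Qed.

Lemma ser_mul_add_r f g h : ser_mul f (ser_add g h) = ser_add (ser_mul f g) (ser_mul f h).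
Proof.
  apply ser_ext; intros m n. unfold ser_add at 2. rewrite !ser_mulE, <- csum_plus.
  apply csum_ext; intros p Hp. rewrite <- tri_plus. apply tri_ext; intros k q H.
  unfold mul_term, ser_add. ring.
Qed.

Lemma ser_mul_scal_l c f g : ser_mul (ser_scal c f) g = ser_scal c (ser_mul f g).
Proof.
  apply ser_ext; intros m n. unfold ser_scal at 2. rewrite !ser_mulE, <- csum_scal.
  apply csum_ext; intros p Hp. rewrite <- tri_scal. apply tri_ext; intros k q H.
  unfold mul_term, ser_scal. ring.
Qed.

Lemma ser_mul_scal_r c f g : ser_mul f (ser_scal c g) = ser_scal c (ser_mul f g).
Proof.
  apply ser_ext; intros m n. unfold ser_scal at 2. rewrite !ser_mulE, <- csum_scal.
  apply csum_ext; intros p Hp. rewrite <- tri_scal. apply tri_ext; intros k q H.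
  unfold mul_term, ser_scal. ring.
Qed.

Lemma ser_mul_one_l f : ser_mul ser_one f = f.
Proof.
  apply ser_ext; intros m n. rewrite ser_mulE, (csum_single m 0), (tri_single n 0 0); try lia.
  - unfold mul_term. rewrite kap_k0. simpl. rewrite Nat.add_0_r, !Nat.sub_0_r. ring.
  - intros k q Hle [H|H]; unfold mul_term.
    + destruct k; [lia|]. destruct q; simpl; [rewrite kap_q0|]; ring.
    + destruct q; [lia|]. simpl. ring.
  - intros p Hp H. apply tri_zero; intros k q Hle. unfold mul_term.
    destruct p; [lia|]. simpl. ring.
Qed.

Lemma ser_mul_one_r f : ser_mul f ser_one = f.
Proof.
  apply ser_ext; intros m n. rewrite ser_mulE, (csum_single m m), (tri_single n 0 n); try lia.
  - unfold mul_term. rewrite kap_k0, !Nat.sub_diag, Nat.sub_0_r, Nat.sub_diag. simpl. ring.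
  - intros k q Hle H. unfold mul_term.
    rewrite Nat.sub_diag, Nat.add_0_l. destruct k; [|simpl; ring].
    destruct (n - 0 - q)%nat eqn:E; [lia|]. simpl; ring.
  - intros p Hp H. apply tri_zero; intros k q Hle. unfold mul_term.
    destruct (m - p + k)%nat eqn:E; [lia|]. simpl; ring.
Qed.

(** * Multiplication and conjugation by b *)

Definition shift (f : ser) : ser := fun m n => match n with O => RtoC 0 | S n' => f m n' end.
Definition der (f : ser) : ser := fun m n => (RtoC (INR m + 1) * f (S m) n)%C.

(* [tau f = b^-1 f b]; since [b^-1 a b = a + b], it sends [a^p] to [a^p + p a^(p-1) b]. *)
Definition tau (f : ser) : ser := ser_add f (shift (der f)).

(** Solves [tau x = f] degree by degree in b, because the derivative term of [tau] only reads the
    preceding degree. *)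
Fixpoint tau_inv (f : ser) (m n : nat) : C :=
  match n with
  | O => f m O
  | S n' => (f m n - RtoC (INR m + 1) * tau_inv f (S m) n')%C
  end.

Lemma tau_tau_inv f : tau (tau_inv f) = f.
Proof.
  apply ser_ext; intros m n. unfold tau, ser_add, shift, der. destruct n; simpl; ring.
Qed.

Lemma tau_inj f g : tau f = tau g -> f = g.
Proof.
  intros H. apply ser_ext. intros m n; revert m. induction n as [|n IH]; intros m.
  - pose proof (f_equal (fun h => h m O) H) as E. unfold tau, ser_add, shift in E.
    rewrite !Cplus_0_r in E. exact E.
  - pose proof (f_equal (fun h => h m (S n)) H) as E. unfold tau, ser_add, shift, der in E.
    rewrite IH in E.
    replace (f m (S n)) with (f m (S n) + RtoC (INR m + 1) * g (S m) n
       - RtoC (INR m + 1) * g (S m) n)%C by ring.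
    rewrite E. ring.
Qed.

Lemma shift_add f g : shift (ser_add f g) = ser_add (shift f) (shift g).
Proof. apply ser_ext; intros m [|n]; unfold shift, ser_add; ring. Qed.

Lemma shift_one : shift ser_one = ser_b.
Proof. apply ser_ext; intros [|m] [|[|n]]; reflexivity. Qed.

(** The coefficient form of b^(q+1) (a^r + r a^(r-1) b) = b^q a^r b, with r = i + k + 1. *)
Lemma kap_step i k q :
  kap i (S k) (S q) + (INR i + INR k + 1) * kap i k (S q) = kap i (S k) q.
Proof.
  assert (Hp : forall k, poch (INR q) (S k) = INR q * poch (INR (S q)) k).
  { clear. induction k as [|k IH].
    - simpl. ring.
    - change (poch (INR q) (S k) * (INR q + INR (S k)) =
        INR q * (poch (INR (S q)) k * (INR (S q) + INR k))).
      rewrite IH, !S_INR. ring. }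
  unfold kap. rewrite Hp.
  transitivity ((-1) ^ k * poch (INR (S q)) k *
    ((INR i + INR k + 1) * bn i k - (INR (S q) + INR k) * bn i (S k))).
  - simpl. ring.
  - rewrite <- bn_S_r. simpl pow. rewrite S_INR. ring.
Qed.

(* [(f g) b = (f b) (b^-1 g b)] *)
Lemma shift_ser_mul_l f g : shift (ser_mul f g) = ser_mul (shift f) (tau g).
Proof.
  apply ser_ext; intros m [|n].
  - unfold shift at 1. rewrite ser_mulE. symmetry.
    apply csum_zero; intros p Hp. apply tri_zero; intros k q H.
    unfold mul_term. replace q with O by lia. simpl. ring.
  - unfold shift at 1. rewrite !ser_mulE. apply csum_ext; intros p Hp.
    rewrite tri_S_second, csum_zero, Cplus_0_l
      by (intros; unfold mul_term; simpl; ring).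
    set (i := (m - p)%nat).
    (* [D] gathers what the derivative part of [tau g] contributes. Delayed by one in k, it combines
       with the other part through [kap_step]. *)
    set (D := fun k q : nat => (RtoC (kap i k (S q) * (INR i + INR k + 1)) *
       (f p q * shift g (S (i + k)) (n - k - q)%nat))%C).
    rewrite (tri_ext n (fun k q => mul_term (shift f) (tau g) m (S n) p k (S q))
      (fun k q => (RtoC (kap i k (S q)) * (f p q * g (i + k)%nat (n - k - q)%nat) + D k q)%C)).
    + rewrite tri_plus, <- (tri_reindex n D), <- tri_plus.
      * apply tri_ext; intros [|k] q H; unfold mul_term; fold i.
        { rewrite !kap_k0. ring. }
        { rewrite <- kap_step. unfold D. rewrite Nat.add_succ_r.
          replace (n - k - q)%nat with (S (n - S k - q)) by lia. simpl shift.
          rewrite !RtoC_plus, !RtoC_mult, !RtoC_plus. ring. }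
      * intros k q H. unfold D. replace (n - k - q)%nat with O by lia. simpl shift. ring.
    + intros k q H. unfold mul_term, D, tau, ser_add. fold i.
      replace (S n - k - S q)%nat with (n - k - q)%nat by lia. simpl (shift f p (S q)).
      destruct (n - k - q)%nat; unfold shift, der;
        rewrite ?RtoC_mult, ?RtoC_plus, ?plus_INR, ?RtoC_plus; ring.
Qed.

Lemma shift_ser_mul_r f g : shift (ser_mul f g) = ser_mul f (shift g).
Proof.
  apply ser_ext; intros m [|n].
  - unfold shift at 1. rewrite ser_mulE. symmetry.
    apply csum_zero; intros p Hp. apply tri_zero; intros k q H.
    unfold mul_term. simpl. ring.
  - unfold shift at 1. rewrite !ser_mulE. apply csum_ext; intros p Hp.
    rewrite tri_S_diag, csum_zero.
    + rewrite Cplus_0_r. apply tri_ext; intros k q H. unfold mul_term.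
      replace (S n - k - q)%nat with (S (n - k - q)) by lia. reflexivity.
    + intros k Hk. unfold mul_term. rewrite Nat.sub_diag. simpl shift. ring.
Qed.

(** The factor m + 1 splits as p + (m + 1 - p): the first part differentiates f, and the second is
    absorbed by [bn_S_l] to differentiate g. *)
Lemma der_ser_mul f g :
  der (ser_mul f g) = ser_add (ser_mul (der f) g) (ser_mul f (der g)).
Proof.
  apply ser_ext; intros m n. unfold ser_add, der at 1. rewrite !ser_mulE, <- csum_scal.
  rewrite (csum_ext (S m) _ (fun p =>
    (RtoC (INR p) * tri n (mul_term f g (S m) n p) +
     RtoC (INR (S m - p)) * tri n (mul_term f g (S m) n p))%C)).
  2:{ intros p Hp. rewrite <- Cmult_plus_distr_r, <- RtoC_plus, <- plus_INR.
      replace (p + (S m - p))%nat with (S m) by lia. now rewrite S_INR. }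
  rewrite csum_plus. f_equal.
  - rewrite csum_S_first. simpl (INR 0). rewrite Cmult_0_l, Cplus_0_l.
    apply csum_ext; intros p Hp. rewrite <- tri_scal. apply tri_ext; intros k q H.
    unfold mul_term, der. rewrite S_INR. simpl (S m - S p)%nat. ring.
  - rewrite csum_S, Nat.sub_diag. simpl (INR 0). rewrite Cmult_0_l, Cplus_0_r.
    apply csum_ext; intros p Hp. rewrite <- tri_scal. apply tri_ext; intros k q H.
    unfold mul_term, der. rewrite Nat.sub_succ_l by lia. set (i := (m - p)%nat).
    transitivity (RtoC (INR (S i) * kap (S i) k q) * (f p q * g (S i + k)%nat (n - k - q)%nat))%C.
    { rewrite RtoC_mult. ring. }
    replace (INR (S i) * kap (S i) k q) with (kap i k q * (INR (i + k) + 1)).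
    { rewrite RtoC_mult. simpl (S i + k)%nat. ring. }
    unfold kap. rewrite S_INR, plus_INR.
    transitivity ((-1) ^ k * poch (INR q) k * ((INR i + 1) * bn (S i) k)).
    { rewrite bn_S_l. ring. }
    ring.
Qed.

(** [shift_ser_mul_l] folds the product of [shift (der f)] and [tau g] back into the shift of
    [der f] times g; Leibniz's rule then matches what remains. *)
Lemma tau_ser_mul f g : tau (ser_mul f g) = ser_mul (tau f) (tau g).
Proof.
  unfold tau at 2. rewrite ser_mul_add_l, <- shift_ser_mul_l.
  unfold tau. rewrite ser_mul_add_r, <- shift_ser_mul_r, der_ser_mul, shift_add.
  apply ser_ext; intros m n. unfold ser_add. ring.
Qed.

Lemma tau_inv_ser_mul f g : tau_inv (ser_mul f g) = ser_mul (tau_inv f) (tau_inv g).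
Proof. apply tau_inj. now rewrite tau_ser_mul, !tau_tau_inv. Qed.

Lemma tau_inv_tau f : tau_inv (tau f) = f.
Proof. apply tau_inj, tau_tau_inv. Qed.

Lemma ser_mul_b_r f : ser_mul f ser_b = shift f.
Proof. now rewrite <- shift_one, <- shift_ser_mul_r, ser_mul_one_r. Qed.

Lemma ser_mul_b_l f : ser_mul ser_b f = shift (tau_inv f).
Proof.
  rewrite <- shift_one, <- (tau_tau_inv f) at 1.
  now rewrite <- shift_ser_mul_l, ser_mul_one_l.
Qed.

Lemma ser_mul_b_l_mul f g :
  ser_mul ser_b (ser_mul f g) = ser_mul (tau_inv f) (ser_mul ser_b g).
Proof.
  now rewrite !ser_mul_b_l, tau_inv_ser_mul, shift_ser_mul_r.
Qed.

Lemma ser_mul_b_r_mul f g :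
  ser_mul (ser_mul f g) ser_b = ser_mul (ser_mul f ser_b) (tau g).
Proof. now rewrite !ser_mul_b_r, shift_ser_mul_l. Qed.

(** * Convergent series *)

Lemma pow_le_1 x n : 1 <= x -> 1 <= x ^ n.
Proof. apply pow_R1_Rle. Qed.

Lemma INR_S_le_pow2 n : INR n + 1 <= 2 ^ n.
Proof.
  induction n as [|n IH]; [simpl; lra|]. rewrite S_INR. simpl.
  pose proof (pow_le_1 2 n). lra.
Qed.

Lemma conv_ser_b : conv ser_b.
Proof.
  exists 2. split; [lra|]. exists 1. split; [lra|]. intros p q.
  assert (H : 1 <= 1 * 2 ^ (p + q) * INR (fact q)).
  { pose proof (pow_le_1 2 (p + q)). pose proof (lt_0_INR _ (lt_O_fact q)).
    assert (1 <= INR (fact q)) by (apply (le_INR 1), lt_O_fact). nra. }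
  unfold ser_b. destruct (_ && _)%bool; rewrite ?Cmod_1, ?Cmod_0; lra.
Qed.

Lemma conv_ser0 : conv ser0.
Proof.
  exists 2. split; [lra|]. exists 1. split; [lra|]. intros p q.
  unfold ser0. rewrite Cmod_0. pose proof (pow_le_1 2 (p + q)).
  pose proof (fact_R_pos q). nra.
Qed.

Lemma conv_scal c f : conv f -> conv (ser_scal c f).
Proof.
  intros (Rr & HR & K & HK & H). exists Rr. split; [exact HR|].
  pose proof (Cmod_ge_0 c).
  exists ((Cmod c + 1) * K). split; [nra|]. intros p q. unfold ser_scal. rewrite Cmod_mult.
  rewrite !Rmult_assoc. apply Rmult_le_compat; try apply Cmod_ge_0; [lra|].
  rewrite <- Rmult_assoc. apply H.
Qed.

Lemma conv_unshift f : conv f -> conv (fun m n => f m (S n)).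
Proof.
  (* Doubling the radius pays for the factor q + 1 of (q + 1)!. *)
  intros (Rr & HR & K & HK & H). exists (2 * Rr). split; [lra|].
  exists (K * Rr). split; [nra|]. intros p q. eapply Rle_trans; [apply H|].
  rewrite Nat.add_succ_r, fact_S_R, Rpow_mult_distr. simpl pow.
  transitivity (K * Rr * Rr ^ (p + q) * INR (fact q) * (INR q + 1)); [right; ring|].
  transitivity (K * Rr * Rr ^ (p + q) * INR (fact q) * 2 ^ (p + q)); [|right; ring].
  apply Rmult_le_compat_l.
  - pose proof (pow_le_1 Rr (p + q)). pose proof (fact_R_pos q).
    apply Rmult_le_pos; [apply Rmult_le_pos|]; nra.
  - eapply Rle_trans; [apply INR_S_le_pow2|]. apply Rle_pow; [lra|lia].
Qed.

Lemma conv_tau f : conv f -> conv (tau f).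
Proof.
  (* The doubled radius pays for the factor m + 1 of the derivative, the doubled constant for the
     two summands. *)
  intros (Rr & HR & K & HK & H). exists (2 * Rr). split; [lra|].
  exists (2 * K). split; [lra|]. intros m n.
  set (X := K * Rr ^ (m + n) * INR (fact n)).
  assert (HX : 0 <= X).
  { unfold X. pose proof (pow_le_1 Rr (m + n)). pose proof (fact_R_pos n).
    apply Rmult_le_pos; [|lra]. nra. }
  assert (H2 : 1 <= 2 ^ (m + n)) by (apply pow_le_1; lra).
  rewrite Rpow_mult_distr.
  replace (2 * K * (2 ^ (m + n) * Rr ^ (m + n)) * INR (fact n))
    with (2 ^ (m + n) * X + 2 ^ (m + n) * X) by (unfold X; ring).
  unfold tau, ser_add. eapply Rle_trans; [apply Cmod_triangle|].
  apply Rplus_le_compat.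
  { pose proof (H m n). fold X in H0. nra. }
  destruct n as [|n]; unfold shift; [rewrite Cmod_0; nra|].
  unfold der. rewrite Cmod_mult, Cmod_R, Rabs_pos_eq by (pose proof (pos_INR m); lra).
  apply Rmult_le_compat; [pose proof (pos_INR m); lra|apply Cmod_ge_0| |].
  - eapply Rle_trans; [apply INR_S_le_pow2|]. apply Rle_pow; [lra|lia].
  - eapply Rle_trans; [apply H|]. unfold X. rewrite Nat.add_succ_r.
    apply Rmult_le_compat_l; [|apply le_INR, fact_le; lia].
    change (S m + n)%nat with (S (m + n)). pose proof (pow_le_1 Rr (S (m + n))). nra.
Qed.

Lemma conv_tau_inv f : conv f -> conv (tau_inv f).
Proof.
  intros (Rr & HR & K & HK & H). exists (4 * Rr). split; [lra|].
  exists K. split; [lra|].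
  (* Unfolding the recursion gives n + 1 terms, all of total degree m + n, each at most the binomial
     coefficient times n!. The radius 4 R then has one factor 2 for n + 1 and one for the binomial
     coefficient. *)
  assert (Hb : forall n m, Cmod (tau_inv f m n) <=
     (INR n + 1) * (K * Rr ^ (m + n) * (bn m n * INR (fact n)))).
  { induction n as [|n IH]; intros m.
    - simpl tau_inv. rewrite bn_0_r. eapply Rle_trans; [apply H|]. simpl. lra.
    - simpl tau_inv. unfold Cminus. eapply Rle_trans; [apply Cmod_triangle|].
      rewrite Cmod_opp, Cmod_mult, Cmod_R, Rabs_pos_eq by (pose proof (pos_INR m); lra).
      specialize (IH (S m)). specialize (H m (S n)).
      replace (S m + n)%nat with (m + S n)%nat in IH by lia.
      set (Z := K * Rr ^ (m + S n)) in *.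
      assert (HZ : 0 <= Z) by (unfold Z; pose proof (pow_le_1 Rr (m + S n)); nra).
      assert (Hbn : 1 <= bn m (S n)).
      { clear. induction m as [|m IHm]; [rewrite bn_0_l; lra|].
        rewrite bn_pascal. pose proof (bn_pos (S m) n). lra. }
      assert (E : (INR m + 1) * bn (S m) n = (INR n + 1) * bn m (S n)).
      { now rewrite bn_S_l, bn_S_r. }
      apply Rle_trans with (Z * (bn m (S n) * INR (fact (S n))) +
        (INR m + 1) * ((INR n + 1) * (Z * (bn (S m) n * INR (fact n))))).
      + apply Rplus_le_compat.
        * eapply Rle_trans; [apply H|]. apply Rmult_le_compat_l; [exact HZ|].
          pose proof (fact_R_pos (S n)). nra.
        * apply Rmult_le_compat_l; [pose proof (pos_INR m); lra|exact IH].
      + right. rewrite (S_INR n), fact_S_R.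
        transitivity (Z * (bn m (S n) * ((INR n + 1) * INR (fact n))) +
          ((INR m + 1) * bn (S m) n) * (INR n + 1) * Z * INR (fact n)); [ring|].
        rewrite E. ring. }
  intros m n. eapply Rle_trans; [apply Hb|].
  replace (4 * Rr) with (2 * (2 * Rr)) by ring. rewrite !Rpow_mult_distr.
  pose proof (fact_R_pos n) as Hf. pose proof (pow_le_1 Rr (m + n) ltac:(lra)) as HRp.
  pose proof (bn_le_pow2 m n). pose proof (bn_pos m n).
  assert (INR n + 1 <= 2 ^ (m + n)).
  { eapply Rle_trans; [apply INR_S_le_pow2|]. apply Rle_pow; [lra|lia]. }
  pose proof (pos_INR n).
  transitivity (((INR n + 1) * bn m n) * (K * Rr ^ (m + n) * INR (fact n))); [right; ring|].
  transitivity ((2 ^ (m + n) * 2 ^ (m + n)) * (K * Rr ^ (m + n) * INR (fact n))); [|right; ring].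
  apply Rmult_le_compat_r.
  - apply Rmult_le_pos; nra.
  - apply Rmult_le_compat; lra.
Qed.

(** * Weierstrass division *)

Lemma poch_add x j k : poch x (j + k) = poch x j * poch (x + INR j) k.
Proof.
  induction k as [|k IH].
  - rewrite Nat.add_0_r. simpl. ring.
  - rewrite Nat.add_succ_r. simpl poch. rewrite IH, plus_INR. ring.
Qed.

Lemma poch_nonneg x k : 0 <= x -> 0 <= poch x k.
Proof.
  intros Hx. induction k as [|k IH]; simpl; [lra|]. pose proof (pos_INR k). nra.
Qed.

Lemma poch_le x y k : 0 <= x <= y -> poch x k <= poch y k.
Proof.
  intros [Hx Hy]. induction k as [|k IH]; simpl; [lra|].
  pose proof (pos_INR k). pose proof (poch_nonneg x k Hx).
  apply Rmult_le_compat; lra.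
Qed.

Lemma poch_bn i k : poch (INR i + 1) k = bn i k * INR (fact k).
Proof.
  induction k as [|k IH].
  - rewrite bn_0_r. simpl. ring.
  - simpl poch. rewrite IH, fact_S_R.
    transitivity (((INR k + 1) * bn i (S k)) * INR (fact k)); [|ring].
    rewrite bn_S_r. ring.
Qed.

Lemma poch_1 k : poch 1 k = INR (fact k).
Proof.
  replace 1 with (INR 0 + 1) by (simpl; ring). rewrite poch_bn, bn_0_l. ring.
Qed.

Lemma poch_shift x n : x * poch (x + 1) n = poch x n * (x + INR n).
Proof.
  induction n as [|n IH]; [simpl; ring|].
  simpl poch. rewrite <- Rmult_assoc, IH, S_INR. ring.
Qed.

(* The weight [A^r B^s (r+2s)!/(r+s)!]. Unlike [A^r B^s s!], it is compatible with the
   product; unlike [A^r B^s (r+s)!/r!], it makes the cost of dividing by [a^P] bounded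
   independently of [s]. *)
Definition wt (A B : R) (r s : nat) : R := A ^ r * B ^ s * poch (INR (r + s) + 1) s.

Lemma wt_nonneg A B r s : 0 <= A -> 0 <= B -> 0 <= wt A B r s.
Proof.
  intros. unfold wt. apply Rmult_le_pos; [apply Rmult_le_pos; now apply pow_le|].
  apply poch_nonneg. pose proof (pos_INR (r + s)). lra.
Qed.

Lemma wt_shift A B P r n :
  0 <= A -> 0 <= B -> wt A B (r + P) n <= (2 * A) ^ P * wt A B r n.
Proof.
  intros HA HB. induction P as [|P IH].
  - rewrite Nat.add_0_r. simpl. lra.
  - rewrite Nat.add_succ_r.
    apply Rle_trans with ((2 * A) * wt A B (r + P) n).
    + unfold wt. simpl pow. rewrite Nat.add_succ_l, S_INR.
      set (x := INR (r + P + n) + 1).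
      assert (Hx : 1 <= x) by (unfold x; pose proof (pos_INR (r + P + n)); lra).
      assert (Hn : INR n <= x) by (unfold x; rewrite plus_INR; pose proof (pos_INR (r + P)); lra).
      (* The quotient of the two rising factorials is (x + n) / x, at most 2 because n <= x. *)
      assert (H : poch (x + 1) n <= 2 * poch x n).
      { apply Rmult_le_reg_l with x; [lra|]. rewrite poch_shift.
        pose proof (poch_nonneg x n ltac:(lra)). nra. }
      replace (A * A ^ (r + P) * B ^ n * poch (x + 1) n)
        with (A * A ^ (r + P) * B ^ n * (poch (x + 1) n)) by ring.
      replace (2 * A * (A ^ (r + P) * B ^ n * poch x n))
        with (A * A ^ (r + P) * B ^ n * (2 * poch x n)) by ring.
      apply Rmult_le_compat_l; [|exact H].
      apply Rmult_le_pos; [apply Rmult_le_pos|]; auto using pow_le.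
    + simpl pow. rewrite (Rmult_assoc (2 * A) _ (wt A B r n)).
      apply Rmult_le_compat_l; [lra|exact IH].
Qed.

(** Together with [conv_of_wt], this passes between the bounds R^(r+s) s! and the weights, up to
    enlarging the radius: the rising factorial in [wt] is s! times a binomial coefficient at most
    2^(r+2s). *)
Lemma fact_le_wt Rf A B r s :
  0 <= Rf -> Rf <= A -> Rf <= B -> Rf ^ (r + s) * INR (fact s) <= wt A B r s.
Proof.
  intros H HA HB. unfold wt. rewrite pow_add, <- poch_1.
  apply Rmult_le_compat.
  - apply Rmult_le_pos; now apply pow_le.
  - apply poch_nonneg; lra.
  - apply Rmult_le_compat; auto using pow_le; apply pow_incr; lra.
  - apply poch_le. pose proof (pos_INR (r + s)). lra.
Qed.

Lemma conv_of_wt A B M f :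
  1 <= A -> 1 <= B -> 0 < M -> (forall r s, Cmod (f r s) <= M * wt A B r s) -> conv f.
Proof.
  intros HA HB HM H. exists (4 * (A + B)). split; [lra|]. exists M. split; [exact HM|].
  intros p q. eapply Rle_trans; [apply H|]. rewrite Rmult_assoc.
  apply Rmult_le_compat_l; [lra|]. unfold wt. rewrite poch_bn, <- Rmult_assoc.
  apply Rmult_le_compat_r; [left; apply fact_R_pos|].
  apply Rle_trans with (A ^ p * B ^ q * (4 ^ p * 4 ^ q)).
  - apply Rmult_le_compat_l; [apply Rmult_le_pos; apply pow_le; lra|].
    eapply Rle_trans; [apply bn_le_pow2|]. rewrite <- pow_add.
    replace 4 with (2 ^ 2) by ring. rewrite <- pow_mult. apply Rle_pow; [lra|lia].
  - rewrite pow_add.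
    replace (A ^ p * B ^ q * (4 ^ p * 4 ^ q)) with ((4 * A) ^ p * (4 * B) ^ q)
      by (rewrite !Rpow_mult_distr; ring).
    apply Rmult_le_compat; try (apply pow_le; lra); apply pow_incr; lra.
Qed.

Lemma csum_geom n F K :
  (forall i, (i <= n)%nat -> Cmod (F i) <= K * (1 / 2) ^ i) -> Cmod (csum n F) <= 2 * K.
Proof.
  intros H. assert (HK : 0 <= K).
  { specialize (H 0%nat ltac:(lia)). simpl in H. pose proof (Cmod_ge_0 (F 0%nat)). lra. }
  assert (Hs : Cmod (csum n F) <= K * (2 - (1 / 2) ^ n)).
  { induction n as [|n IH].
    - rewrite csum_0. specialize (H 0%nat ltac:(lia)). simpl in *. lra.
    - rewrite csum_S. eapply Rle_trans; [apply Cmod_triangle|].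
      specialize (IH ltac:(intros; apply H; lia)). specialize (H (S n) ltac:(lia)).
      simpl pow in *. nra. }
  pose proof (pow_le (1 / 2) n ltac:(lra)). nra.
Qed.

Lemma csum_tri_geom m n (F : nat -> nat -> nat -> C) K :
  (forall i k j, (i <= m)%nat -> (k + j <= n)%nat ->
     Cmod (F i k j) <= K * (1 / 2) ^ (i + k + j)) ->
  Cmod (csum m (fun i => tri n (F i))) <= 8 * K.
Proof.
  intros H. replace (8 * K) with (2 * (2 * (2 * K))) by ring.
  apply csum_geom; intros i Hi.
  replace (2 * (2 * K) * (1 / 2) ^ i) with (2 * (2 * (K * (1 / 2) ^ i))) by ring.
  apply csum_geom; intros k Hk.
  replace (2 * (K * (1 / 2) ^ i) * (1 / 2) ^ k) with (2 * (K * (1 / 2) ^ i * (1 / 2) ^ k)) by ring.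
  apply csum_geom; intros j Hj.
  eapply Rle_trans; [apply H; lia|]. rewrite !pow_add. right; ring.
Qed.

(** The entry at (r, n) of the iterates of T no longer changes after [w r n + 1] steps, so the limit
    can be read off entrywise. *)
Lemma causal_fixpoint (T : ser -> ser) (w : nat -> nat -> nat) :
  (forall x y r n, (forall r' n', (w r' n' < w r n)%nat -> x r' n' = y r' n') ->
     T x r n = T y r n) ->
  exists x, forall r n, x r n = T x r n.
Proof.
  intros H. set (it := fun t => Nat.iter t T ser0).
  assert (Hst : forall t t' r n, (w r n < t)%nat -> (w r n < t')%nat ->
                  it t r n = it t' r n).
  { induction t as [|t IH]; intros [|t'] r n Ht Ht'; try lia.
    apply (H (it t) (it t')). intros r' n' Hw. apply IH; lia. }
  exists (fun r n => it (S (w r n)) r n). intros r n.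
  apply (H (it (w r n))). intros r' n' Hw. apply Hst; lia.
Qed.

(* First [A], then [B] large enough: the factor [(2A)^P] lost when dividing by
   [a^P] is beaten by [(R/A)^(P+1)] when [t = 0], by [1/B] otherwise. *)
Lemma weights_exist P H Rg R0 eps :
  0 < H -> 1 <= Rg -> 1 <= R0 -> 0 < eps ->
  exists A B, R0 <= A /\ R0 <= B /\ Rg <= A /\
    forall i t, (P < i \/ 0 < t)%nat ->
      H * (2 * Rg / A) ^ i * (2 * A / B) ^ t * (2 * A) ^ P <= eps * (1 / 2) ^ (i + t).
Proof.
  intros HH HRg HR0 Heps.
  (* The worst cases i = P + 1 and t = 1 come out as a0 eps / A and b0 eps / B. The summands 4 Rg in
     A and 4 A in B make both ratios at most 1/2, which leaves the factor (1/2)^(i+t). *)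
  set (a0 := 4 * Rg * (8 * Rg) ^ P * H / eps).
  assert (Ha0 : 0 <= a0).
  { unfold a0. apply Rmult_le_pos; [|left; now apply Rinv_0_lt_compat].
    pose proof (pow_le (8 * Rg) P ltac:(lra)). apply Rmult_le_pos; [|lra]. nra. }
  set (A := 4 * Rg + R0 + a0).
  assert (HA : 0 < A) by (unfold A; lra).
  pose proof (pow_lt (2 * A) P ltac:(lra)) as HAP.
  set (b0 := (2 * A) ^ P * H * (4 * A) / eps).
  assert (Hb0 : 0 <= b0).
  { unfold b0. apply Rmult_le_pos; [|left; now apply Rinv_0_lt_compat].
    apply Rmult_le_pos; nra. }
  set (B := 4 * A + b0).
  assert (HB : 0 < B) by (unfold B; lra).
  exists A, B. repeat split; try (unfold B; unfold A; lra).
  intros i t Hit.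
  replace (2 * Rg / A) with (1 / 2 * (4 * Rg / A)) by (field; lra).
  replace (2 * A / B) with (1 / 2 * (4 * A / B)) by (field; lra).
  rewrite (Rpow_mult_distr (1 / 2) (4 * Rg / A)), (Rpow_mult_distr (1 / 2) (4 * A / B)), pow_add.
  assert (Hx : 0 <= 4 * Rg / A <= 1).
  { split; [apply Rmult_le_pos; [lra|left; now apply Rinv_0_lt_compat]|].
    apply (Rmult_le_reg_r A); [lra|]. unfold Rdiv. rewrite Rmult_assoc, Rinv_l by lra.
    unfold A; lra. }
  assert (Hy : 0 <= 4 * A / B <= 1).
  { split; [apply Rmult_le_pos; [lra|left; now apply Rinv_0_lt_compat]|].
    apply (Rmult_le_reg_r B); [lra|]. unfold Rdiv. rewrite Rmult_assoc, Rinv_l by lra.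
    unfold B; lra. }
  set (x := 4 * Rg / A) in *. set (y := 4 * A / B) in *.
  assert (Hdec : forall z d e, 0 <= z <= 1 -> (d <= e)%nat -> z ^ e <= z ^ d).
  { clear. intros z d e Hz Hde. replace e with (d + (e - d))%nat by lia. rewrite pow_add.
    pose proof (pow_le z d ltac:(lra)). pose proof (pow_incr z 1 (e - d) Hz) as H1.
    rewrite pow1 in H1. nra. }
  cut (H * (2 * A) ^ P * (x ^ i * y ^ t) <= eps).
  { intros Hc. pose proof (pow_lt (1 / 2) i ltac:(lra)). pose proof (pow_lt (1 / 2) t ltac:(lra)).
    replace (H * ((1 / 2) ^ i * x ^ i) * ((1 / 2) ^ t * y ^ t) * (2 * A) ^ P)
      with ((H * (2 * A) ^ P * (x ^ i * y ^ t)) * ((1 / 2) ^ i * (1 / 2) ^ t)) by ring.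
    apply Rmult_le_compat_r; [|exact Hc]. nra. }
  pose proof (pow_le x i ltac:(lra)) as Hxi. pose proof (pow_le y t ltac:(lra)) as Hyt.
  pose proof (Hdec x 0%nat i Hx ltac:(lia)) as Hxi1. simpl in Hxi1.
  pose proof (Hdec y 0%nat t Hy ltac:(lia)) as Hyt1. simpl in Hyt1.
  destruct Hit as [Hi|Ht].
  - pose proof (Hdec x (S P) i Hx ltac:(lia)) as Hle.
    apply Rle_trans with (H * (2 * A) ^ P * x ^ S P).
    + apply Rmult_le_compat_l; [nra|]. nra.
    + unfold x. simpl pow.
      replace (H * (2 * A) ^ P * (4 * Rg / A * (4 * Rg / A) ^ P))
        with (H * (4 * Rg / A) * ((2 * A) ^ P * (4 * Rg / A) ^ P)) by ring.
      rewrite <- Rpow_mult_distr. replace (2 * A * (4 * Rg / A)) with (8 * Rg) by (field; lra).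
      replace (H * (4 * Rg / A) * (8 * Rg) ^ P) with (a0 * eps / A).
      2:{ unfold a0. field. lra. }
      apply (Rmult_le_reg_r A); [lra|]. unfold Rdiv. rewrite Rmult_assoc, Rinv_l by lra.
      assert (a0 <= A) by (unfold A; lra). nra.
  - pose proof (Hdec y 1%nat t Hy ltac:(lia)) as Hle. rewrite pow_1 in Hle.
    apply Rle_trans with (H * (2 * A) ^ P * y).
    + apply Rmult_le_compat_l; [nra|]. nra.
    + unfold y. replace (H * (2 * A) ^ P * (4 * A / B)) with (b0 * eps / B).
      2:{ unfold b0. field. lra. }
      apply (Rmult_le_reg_r B); [lra|]. unfold Rdiv. rewrite Rmult_assoc, Rinv_l by lra.
      assert (b0 <= B) by (unfold B; lra). nra.
Qed.

(* Common shape of the maps [x |-> g x] and [x |-> x g]; the coefficient of [a^i b^j] in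
   [g] enters [c m n i 0 j]. *)
Definition tri_op (c : nat -> nat -> nat -> nat -> nat -> C) (io : nat -> nat -> nat -> nat)
  (x : ser) (m n : nat) : C :=
  csum m (fun i => tri n (fun k j => (c m n i k j * x (io m i k) (n - k - j)%nat)%C)).

(** The term i = P, k = j = 0 isolates u times the entry of x at (m - P, n). The other terms read
    entries of lower rank, so x is found recursively, and in a suitable weight they cost at most
    half of the bound to be proved. *)
Lemma tri_op_solve c io P u H Rg f :
  (forall m i k, (io m i k <= m - i + k)%nat) ->
  (forall m i, io m i 0%nat = (m - i)%nat) ->
  (forall m n i, (i < P)%nat -> c m n i 0%nat 0%nat = RtoC 0) ->
  (forall m n, c m n P 0%nat 0%nat = u) -> u <> RtoC 0 ->
  0 < H -> 1 <= Rg ->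
  (forall A B m n i k j, Rg <= A -> 1 <= B -> (i <= m)%nat -> (k + j <= n)%nat ->
     Cmod (c m n i k j) * wt A B (io m i k) (n - k - j) <=
     H * (2 * Rg / A) ^ i * (2 * A / B) ^ (k + j) * wt A B m n) ->
  conv f ->
  exists x, conv x /\ forall m n, (P <= m)%nat -> tri_op c io x m n = f m n.
Proof.
  intros Hio Hio0 Hlow Hlead Hu HH HRg Hc (Rf & HRf & F & HF & Hf).
  (* The terms i < P with k = j = 0 are also set aside: their coefficients vanish, but they would
     read entries of x beyond the one being solved. *)
  set (lead := fun i k j : nat => (Nat.leb i P && Nat.eqb k 0 && Nat.eqb j 0)%bool).
  set (c' := fun m n i k j => if lead i k j then RtoC 0 else c m n i k j).
  assert (Hlead_t : forall i k j, lead i k j = true -> (i <= P /\ k = 0 /\ j = 0)%nat).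
  { unfold lead. intros i k j E. destruct (Nat.leb_spec i P), (Nat.eqb_spec k 0), (Nat.eqb_spec j 0);
      try discriminate. lia. }
  assert (Hlead_f : forall i k j, lead i k j = false -> (P < i \/ 0 < k + j)%nat).
  { unfold lead. intros i k j E. destruct (Nat.leb_spec i P), (Nat.eqb_spec k 0), (Nat.eqb_spec j 0);
      try discriminate; lia. }
  (* Lowering n by k + j >= 1 can raise r by up to P + k, which the slope P + 2 outweighs. *)
  set (w := fun r n : nat => (r + (P + 2) * n)%nat).
  assert (Hw : forall r n i k j, (i <= r + P)%nat -> (k + j <= n)%nat -> lead i k j = false ->
     (w (io (r + P) i k) (n - k - j) < w r n)%nat).
  { intros r n i k j Hi Hkj E. apply Hlead_f in E. unfold w. specialize (Hio (r + P)%nat i k).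
    set (s := (n - k - j)%nat). replace n with (s + (k + j))%nat by (unfold s; lia).
    nia. }
  destruct (causal_fixpoint
    (fun x r n => (/ u * (f (r + P)%nat n - tri_op c' io x (r + P) n))%C) w) as [x Hx].
  { intros x y r n Hxy. do 2 f_equal. apply csum_ext; intros i Hi.
    apply tri_ext; intros k j Hkj. unfold c'. destruct (lead i k j) eqn:E; [ring|].
    f_equal. apply Hxy. now apply Hw. }
  exists x. split.
  - pose proof (proj1 (Cmod_gt_0 u) Hu) as Hup.
    (* The three nested geometric sums cost a factor 8, so after division by u the terms of lower
       rank use up half of M. *)
    destruct (weights_exist P H Rg Rf (Cmod u / 16)) as (A & B & HAf & HBf & HAg & Hsm);
      try lra.
    assert (H2A : 0 < (2 * A) ^ P) by (apply pow_lt; lra).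
    (* The other half of M pays for f, shifted by P rows. *)
    set (M := 2 * F * (2 * A) ^ P / Cmod u).
    assert (HM : 0 < M).
    { unfold M. apply Rdiv_lt_0_compat; [|exact Hup]. apply Rmult_lt_0_compat; lra. }
    apply (conv_of_wt A B M); try lra.
    assert (Hind : forall N r n, (w r n < N)%nat -> Cmod (x r n) <= M * wt A B r n).
    2:{ intros r n. apply (Hind (S (w r n))). lia. }
    induction N as [|N IH]; intros r n HN; [lia|].
    rewrite Hx, Cmod_mult, Cmod_inv by exact Hu.
    set (m := (r + P)%nat).
    set (K := M * (Cmod u / 16) * wt A B m n / (2 * A) ^ P).
    pose proof (wt_nonneg A B m n ltac:(lra) ltac:(lra)) as Hwm.
    assert (HL : Cmod (tri_op c' io x m n) <= 8 * K).
    { apply csum_tri_geom. intros i k j Hi Hkj. unfold c'. destruct (lead i k j) eqn:E.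
      - rewrite Cmult_0_l, Cmod_0. apply Rmult_le_pos; [|apply pow_le; lra].
        unfold K. apply Rmult_le_pos; [|left; now apply Rinv_0_lt_compat].
        apply Rmult_le_pos; [|exact Hwm]. nra.
      - rewrite Cmod_mult.
        pose proof (Hw r n i k j Hi Hkj E) as Hlt. fold m in Hlt.
        specialize (IH (io m i k) (n - k - j)%nat ltac:(lia)).
        apply Rle_trans with (M * (Cmod (c m n i k j) * wt A B (io m i k) (n - k - j))).
        { rewrite <- Rmult_assoc, (Rmult_comm M), Rmult_assoc.
          apply Rmult_le_compat_l; [apply Cmod_ge_0|exact IH]. }
        apply (Rmult_le_reg_r ((2 * A) ^ P)); [exact H2A|].
        unfold K.
        replace (M * (Cmod u / 16) * wt A B m n / (2 * A) ^ P * (1 / 2) ^ (i + k + j) * (2 * A) ^ P)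
          with (M * wt A B m n * (Cmod u / 16 * (1 / 2) ^ (i + k + j))) by (field; lra).
        rewrite <- Nat.add_assoc.
        apply Rle_trans with (M * wt A B m n *
          (H * (2 * Rg / A) ^ i * (2 * A / B) ^ (k + j) * (2 * A) ^ P)).
        + replace (M * wt A B m n * (H * (2 * Rg / A) ^ i * (2 * A / B) ^ (k + j) * (2 * A) ^ P))
            with (M * (H * (2 * Rg / A) ^ i * (2 * A / B) ^ (k + j) * wt A B m n) * (2 * A) ^ P) by ring.
          apply Rmult_le_compat_r; [lra|]. apply Rmult_le_compat_l; [lra|].
          apply Hc; lra || assumption.
        + apply Rmult_le_compat_l; [nra|]. apply Hsm. now apply Hlead_f. }
    assert (HFm : Cmod (f m n) <= F * wt A B m n).
    { eapply Rle_trans; [apply Hf|]. rewrite Rmult_assoc. apply Rmult_le_compat_l; [lra|].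
      apply fact_le_wt; lra. }
    pose proof (wt_shift A B P r n ltac:(lra) ltac:(lra)) as Hws. fold m in Hws.
    apply (Rmult_le_reg_l (Cmod u)); [exact Hup|].
    rewrite <- Rmult_assoc, Rinv_r, Rmult_1_l by lra.
    apply Rle_trans with ((F + 8 * (M * (Cmod u / 16)) / (2 * A) ^ P) * wt A B m n).
    { unfold Cminus. eapply Rle_trans; [apply Cmod_triangle|]. rewrite Cmod_opp.
      unfold K in HL.
      replace ((F + 8 * (M * (Cmod u / 16)) / (2 * A) ^ P) * wt A B m n) with
        (F * wt A B m n + 8 * (M * (Cmod u / 16) * wt A B m n / (2 * A) ^ P)) by (field; lra).
      lra. }
    apply Rle_trans with ((F + 8 * (M * (Cmod u / 16)) / (2 * A) ^ P) * ((2 * A) ^ P * wt A B r n)).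
    { apply Rmult_le_compat_l; [|exact Hws].
      assert (0 <= 8 * (M * (Cmod u / 16)) / (2 * A) ^ P); [|lra].
      apply Rmult_le_pos; [nra|left; now apply Rinv_0_lt_compat]. }
    right. unfold M. field. lra.
  - intros m n HPm. set (r := (m - P)%nat).
    assert (E : tri_op c io x m n = (tri_op c' io x m n + u * x r n)%C).
    { transitivity (tri_op c' io x m n + csum m (fun i => tri n (fun k j =>
        ((if lead i k j then c m n i k j else RtoC 0) * x (io m i k) (n - k - j)%nat)%C)))%C.
      - unfold tri_op. rewrite <- csum_plus. apply csum_ext; intros i Hi.
        rewrite <- tri_plus. apply tri_ext; intros k j Hkj. unfold c'.
        destruct (lead i k j); ring.
      - f_equal. rewrite (csum_single m P), (tri_single n 0 0); try lia.
        + unfold lead. rewrite Nat.leb_refl. simpl andb. cbv iota.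
          rewrite Hlead, Hio0, !Nat.sub_0_r. reflexivity.
        + intros k j Hkj Hne. destruct (lead P k j) eqn:El; [|ring].
          apply Hlead_t in El. lia.
        + intros i Hi Hne. apply tri_zero; intros k j Hkj.
          destruct (lead i k j) eqn:El; [|ring]. apply Hlead_t in El.
          destruct El as (El & -> & ->). rewrite Hlow by lia. ring. }
    rewrite E. rewrite (Hx r n). replace (r + P)%nat with m by (unfold r; lia).
    field. exact Hu.
Qed.

(** * Product estimates and division on both sides *)

Lemma Cmod_kap i k q : Cmod (RtoC (kap i k q)) = bn i k * poch (INR q) k.
Proof.
  unfold kap. rewrite Cmod_R, Rmult_assoc, Rabs_mult, pow_1_abs, Rmult_1_l.
  apply Rabs_pos_eq. apply Rmult_le_pos; [left; apply bn_pos|].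
  apply poch_nonneg, pos_INR.
Qed.

Lemma poch_3_le N x y z s k j :
  0 <= x <= INR N + 1 -> 0 <= y <= INR N + 1 -> 0 <= z <= INR N + 1 ->
  poch x s * (poch y k * poch z j) <= poch (INR N + 1) (s + k + j).
Proof.
  intros Hx Hy Hz. rewrite !poch_add, Rmult_assoc.
  pose proof (pos_INR s). pose proof (pos_INR k). pose proof (pos_INR (s + k)).
  apply Rmult_le_compat; [apply poch_nonneg; lra| |apply poch_le; lra|].
  - apply Rmult_le_pos; apply poch_nonneg; lra.
  - apply Rmult_le_compat; try apply poch_nonneg; try apply poch_le; lra.
Qed.

(** The binomial coefficient involves the exponent i0 of the unknown, so a bound by a power of 2
    would be too costly. Instead (j)_k is traded for 2^(k+j) k!, the k! turns the binomial
    coefficient into (i0+1)_k, and three rising factorials merge into one. *)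
Lemma weight_right_le i0 k j s N :
  (i0 + k + s <= N)%nat ->
  bn i0 k * poch (INR j) k * (INR (fact j) * poch (INR (i0 + k + s) + 1) s) <=
  2 ^ (k + j) * poch (INR N + 1) (s + k + j).
Proof.
  intros HN. pose proof (pos_INR j) as Hj. pose proof (bn_pos i0 k) as Hb.
  pose proof (fact_R_pos j) as Hf.
  assert (Hp : poch (INR j) k <= 2 ^ (k + j) * INR (fact k)).
  { apply Rle_trans with (poch (INR j + 1) k); [apply poch_le; lra|].
    rewrite poch_bn. apply Rmult_le_compat_r; [left; apply fact_R_pos|].
    rewrite Nat.add_comm. apply bn_le_pow2. }
  assert (Hq : 0 <= poch (INR (i0 + k + s) + 1) s).
  { apply poch_nonneg. pose proof (pos_INR (i0 + k + s)). lra. }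
  apply Rle_trans with (2 ^ (k + j) *
    (poch (INR (i0 + k + s) + 1) s * (poch (INR i0 + 1) k * poch 1 j))).
  - rewrite (poch_bn i0), poch_1.
    transitivity (poch (INR j) k * (bn i0 k * INR (fact j) * poch (INR (i0 + k + s) + 1) s));
      [right; ring|].
    transitivity ((2 ^ (k + j) * INR (fact k)) *
      (bn i0 k * INR (fact j) * poch (INR (i0 + k + s) + 1) s)); [|right; ring].
    apply Rmult_le_compat_r; [|exact Hp].
    apply Rmult_le_pos; [|exact Hq]. nra.
  - apply Rmult_le_compat_l; [apply pow_le; lra|].
    apply le_INR in HN. rewrite !plus_INR in HN.
    pose proof (pos_INR i0). pose proof (pos_INR s). pose proof (pos_INR k).
    apply poch_3_le; rewrite ?plus_INR; lra.
Qed.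

(** Here i + k is an exponent of g, so the binomial coefficient may be bounded by 2^(i+k); the
    rising factorials merge as they are. *)
Lemma weight_left_le i k p q j N :
  (p + q <= N)%nat -> bn i k * poch (INR q) k * (INR (fact j) * poch (INR (p + q) + 1) q) <=
  2 ^ (i + k) * poch (INR N + 1) (q + k + j).
Proof.
  intros HN. pose proof (bn_pos i k). pose proof (pos_INR q). pose proof (pos_INR p).
  pose proof (pos_INR (p + q)).
  transitivity (bn i k * (poch (INR (p + q) + 1) q * (poch (INR q) k * poch 1 j))).
  { right. rewrite poch_1. ring. }
  apply Rmult_le_compat; [lra| |apply bn_le_pow2|].
  - apply Rmult_le_pos; [|apply Rmult_le_pos]; apply poch_nonneg; lra.
  - apply le_INR in HN. rewrite plus_INR in *. apply poch_3_le; lra.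
Qed.

Lemma wt_rescale A B Rg i i0 e s d N :
  0 < A -> 0 < B -> (i + i0 + (e + s))%nat = N -> (e + s)%nat = d ->
  (2 * Rg / A) ^ i * (2 * A / B) ^ e * wt A B (i + i0) d =
  (2 * Rg) ^ i * (2 * A) ^ e * (A ^ i0 * B ^ s) * poch (INR N + 1) d.
Proof.
  intros HA HB <- <-. unfold wt. rewrite !pow_add. unfold Rdiv.
  rewrite (Rpow_mult_distr (2 * Rg)), (Rpow_mult_distr (2 * A)), !pow_inv.
  field. split; apply pow_nonzero; lra.
Qed.

(** The letters a of the unknown are the ones that get reordered, so the entry it contributes lies
    in row m - i + k. *)
Lemma division_right g f P :
  conv g -> conv f -> (forall i, (i < P)%nat -> g i 0%nat = RtoC 0) -> g P 0%nat <> RtoC 0 ->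
  exists q, conv q /\ forall m n, (P <= m)%nat -> ser_mul g q m n = f m n.
Proof.
  intros (Rg & HRg & H & HH & Hg) Hf Hlow Hu.
  destruct (tri_op_solve (fun m n i k j => (RtoC (kap (m - i) k j) * g i j)%C)
    (fun m i k => (m - i + k)%nat) P (g P 0%nat) H Rg f) as (q & Hq & E); try lra; auto.
  - intros; lia.
  - intros m n i Hi. rewrite Hlow by exact Hi. ring.
  - intros m n. rewrite kap_k0. ring.
  - intros A B m n i k j HA HB Hi Hkj. rewrite Cmod_mult, Cmod_kap.
    set (i0 := (m - i)%nat). set (s := (n - k - j)%nat).
    replace m with (i + i0)%nat by (unfold i0; lia).
    rewrite (Rmult_assoc H), (Rmult_assoc H), (wt_rescale A B Rg i i0 (k + j) s n (i + i0 + n));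
      [|lra|lra|unfold s; lia|unfold s; lia].
    specialize (Hg i j).
    pose proof (weight_right_le i0 k j s (i + i0 + n) ltac:(unfold s; lia)) as Hw.
    replace (s + k + j)%nat with n in Hw by (unfold s; lia).
    assert (H2 : 1 <= 2 ^ i) by (apply pow_le_1; lra).
    assert (Hp : 0 <= bn i0 k * poch (INR j) k).
    { apply Rmult_le_pos; [left; apply bn_pos|apply poch_nonneg, pos_INR]. }
    assert (Hwn : 0 <= wt A B (i0 + k) s) by (apply wt_nonneg; lra).
    apply Rle_trans with (bn i0 k * poch (INR j) k * (H * Rg ^ (i + j) * INR (fact j))
       * wt A B (i0 + k) s).
    { apply Rmult_le_compat_r; [exact Hwn|]. now apply Rmult_le_compat_l. }
    unfold wt. rewrite !(pow_add _ i0 k), (pow_add Rg).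
    rewrite (Rpow_mult_distr 2 Rg), (Rpow_mult_distr 2 A), (pow_add A).
    transitivity ((H * Rg ^ i * A ^ k * (A ^ i0 * B ^ s)) * Rg ^ j *
      (bn i0 k * poch (INR j) k * (INR (fact j) * poch (INR (i0 + k + s) + 1) s)));
      [right; ring|].
    transitivity ((H * Rg ^ i * A ^ k * (A ^ i0 * B ^ s)) * (2 ^ i * A ^ j) *
      (2 ^ (k + j) * poch (INR (i + i0 + n) + 1) n)); [|right; ring].
    assert (Hnn : 0 <= H * Rg ^ i * A ^ k * (A ^ i0 * B ^ s)).
    { repeat apply Rmult_le_pos; try (apply pow_le); lra. }
    assert (Hj : Rg ^ j <= A ^ j) by (apply pow_incr; lra).
    assert (Hj0 : 0 <= Rg ^ j) by (apply pow_le; lra).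
    apply Rmult_le_compat; [| | |exact Hw].
    + now apply Rmult_le_pos.
    + apply Rmult_le_pos; [exact Hp|]. apply Rmult_le_pos; [left; apply fact_R_pos|].
      apply poch_nonneg. pose proof (pos_INR (i0 + k + s)). lra.
    + apply Rmult_le_compat_l; [exact Hnn|]. nra.
  - exists q. split; [exact Hq|]. intros m n Hm. rewrite <- E by exact Hm.
    rewrite ser_mulE. apply csum_ext; intros i Hi. apply tri_ext; intros k j Hkj.
    unfold mul_term. ring.
Qed.

(** Now the letters a of g cross the powers of b of the unknown: g contributes a^(i+k) b^j, and k of
    its letters a turn into b. *)
Lemma division_left g f P :
  conv g -> conv f -> (forall i, (i < P)%nat -> g i 0%nat = RtoC 0) -> g P 0%nat <> RtoC 0 ->
  exists q, conv q /\ forall m n, (P <= m)%nat -> ser_mul q g m n = f m n.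
Proof.
  intros (Rg & HRg & H & HH & Hg) Hf Hlow Hu.
  destruct (tri_op_solve (fun m n i k j => (RtoC (kap i k (n - k - j)) * g (i + k)%nat j)%C)
    (fun m i k => (m - i)%nat) P (g P 0%nat) H Rg f) as (q & Hq & E); try lra; auto.
  - intros; lia.
  - intros m n i Hi. rewrite Nat.add_0_r, Hlow by exact Hi. ring.
  - intros m n. rewrite kap_k0, Nat.add_0_r. ring.
  - intros A B m n i k j HA HB Hi Hkj. rewrite Cmod_mult, Cmod_kap.
    set (p := (m - i)%nat). set (s := (n - k - j)%nat).
    replace m with (i + p)%nat by (unfold p; lia).
    rewrite (Rmult_assoc H), (Rmult_assoc H), (wt_rescale A B Rg i p (k + j) s n (i + p + n));
      [|lra|lra|unfold s; lia|unfold s; lia].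
    specialize (Hg (i + k)%nat j).
    pose proof (weight_left_le i k p s j (i + p + n) ltac:(unfold s; lia)) as Hw.
    replace (s + k + j)%nat with n in Hw by (unfold s; lia).
    assert (Hp : 0 <= bn i k * poch (INR s) k).
    { apply Rmult_le_pos; [left; apply bn_pos|apply poch_nonneg, pos_INR]. }
    assert (Hwn : 0 <= wt A B p s) by (apply wt_nonneg; lra).
    apply Rle_trans with (bn i k * poch (INR s) k * (H * Rg ^ (i + k + j) * INR (fact j))
       * wt A B p s).
    { apply Rmult_le_compat_r; [exact Hwn|]. now apply Rmult_le_compat_l. }
    unfold wt. rewrite <- Nat.add_assoc, (pow_add Rg).
    rewrite (Rpow_mult_distr 2 Rg), (Rpow_mult_distr 2 A), (pow_add 2).
    transitivity ((H * Rg ^ i * (A ^ p * B ^ s)) * Rg ^ (k + j) *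
      (bn i k * poch (INR s) k * (INR (fact j) * poch (INR (p + s) + 1) s)));
      [right; ring|].
    transitivity ((H * Rg ^ i * (A ^ p * B ^ s)) * (2 ^ j * A ^ (k + j)) *
      (2 ^ (i + k) * poch (INR (i + p + n) + 1) n)); [|right; rewrite !pow_add; ring].
    assert (Hnn : 0 <= H * Rg ^ i * (A ^ p * B ^ s)).
    { repeat apply Rmult_le_pos; try (apply pow_le); lra. }
    assert (Hj : Rg ^ (k + j) <= A ^ (k + j)) by (apply pow_incr; lra).
    assert (Hj0 : 0 <= Rg ^ (k + j)) by (apply pow_le; lra).
    assert (H2 : 1 <= 2 ^ j) by (apply pow_le_1; lra).
    apply Rmult_le_compat; [| | |exact Hw].
    + now apply Rmult_le_pos.
    + apply Rmult_le_pos; [exact Hp|]. apply Rmult_le_pos; [left; apply fact_R_pos|].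
      apply poch_nonneg. pose proof (pos_INR (p + s)). lra.
    + apply Rmult_le_compat_l; [exact Hnn|]. nra.
  - exists q. split; [exact Hq|]. intros m n Hm. rewrite <- E by exact Hm.
    (* [ser_mulE] is indexed by the exponents of the left factor, here the unknown; reversing both
       sums indexes it by those of g. *)
    rewrite ser_mulE, csum_rev. apply csum_ext; intros i Hi. rewrite tri_antidiag.
    apply tri_ext; intros k j Hkj. unfold mul_term.
    replace (m - (m - i))%nat with i by lia.
    replace (n - k - (n - k - j))%nat with j by lia. ring.
Qed.

(** * Ideals *)

Definition leading (f : ser) (P : nat) : Prop :=
  (forall i, (i < P)%nat -> f i 0%nat = RtoC 0) /\ f P 0%nat <> RtoC 0.

(* [mul] stands for [ser_mul] or for the opposite product. *)
Definition ideal (mul : ser -> ser -> ser) (I : ser -> Prop) : Prop :=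
  (forall x, I x -> conv x) /\ I ser0 /\
  (forall x y, I x -> I y -> I (ser_add x y)) /\
  (forall r x, conv r -> I x -> I (mul x r)).

(** An interface met by the product and its opposite, so that left and right ideals are treated at
    once. [wm_mul_b] says that b can be moved past q. The last clause of [wm_div_b] says that
    dividing by b preserves the lowest b-coefficient, even when it involves a conjugation. *)
Record weierstrass_mul (mul : ser -> ser -> ser) : Prop := {
  wm_scal : forall c x y, mul x (ser_scal c y) = ser_scal c (mul x y);
  wm_add_b : forall x y, mul (ser_add x y) ser_b = ser_add (mul x ser_b) (mul y ser_b);
  wm_conv_b : forall x, conv (mul x ser_b) -> conv x;
  wm_mul_b : forall q, conv q ->
    exists q', conv q' /\ forall g, mul (mul g q) ser_b = mul (mul g ser_b) q';
  wm_div_b : forall f, conv f -> (forall m, f m 0%nat = RtoC 0) ->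
    exists f', conv f' /\ f = mul f' ser_b /\
      forall n, (forall m j, (j <= n)%nat -> f m j = RtoC 0) -> forall m, f' m n = f m (S n);
  wm_division : forall g f P, conv g -> conv f -> leading g P ->
    exists q, conv q /\ forall m n, (P <= m)%nat -> mul g q m n = f m n
}.

Lemma weierstrass_ser_mul : weierstrass_mul ser_mul.
Proof.
  split.
  - intros. apply ser_mul_scal_r.
  - intros. apply ser_mul_add_l.
  - intros x. rewrite ser_mul_b_r. exact (conv_unshift (shift x)).
  - intros q Hq. exists (tau q). split; [now apply conv_tau|].
    intros g. apply ser_mul_b_r_mul.
  - intros f Hf H0. exists (fun m n => f m (S n)). split; [now apply conv_unshift|]. split.
    + rewrite ser_mul_b_r. apply ser_ext; intros m [|n]; simpl; auto.
    + reflexivity.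
  - intros g f P Hg Hf [Hlow Hu]. now apply division_right.
Qed.

Lemma weierstrass_ser_mul_op : weierstrass_mul (fun x r => ser_mul r x).
Proof.
  split.
  - intros. apply ser_mul_scal_l.
  - intros. apply ser_mul_add_r.
  - intros x. rewrite ser_mul_b_l. intros Hx. rewrite <- (tau_tau_inv x).
    apply conv_tau. exact (conv_unshift _ Hx).
  - intros q Hq. exists (tau_inv q). split; [now apply conv_tau_inv|].
    intros g. apply ser_mul_b_l_mul.
  (* The left quotient b^-1 f is the conjugate by b of the right quotient f b^-1. *)
  - intros f Hf H0. exists (tau (fun m n => f m (S n))).
    split; [now apply conv_tau, conv_unshift|]. split.
    + rewrite ser_mul_b_l, tau_inv_tau. apply ser_ext; intros m [|n]; simpl; auto.
    + intros n Hn m. unfold tau, ser_add, shift, der.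
      destruct n as [|n]; [ring|]. rewrite (Hn (S m) (S n)) by lia. ring.
  - intros g f P Hg Hf [Hlow Hu]. now apply division_left.
Qed.

Lemma least_nat (Q : nat -> Prop) :
  (exists n, Q n) -> exists n, Q n /\ forall k, Q k -> (n <= k)%nat.
Proof.
  intros [n Hn]. revert Hn. induction n as [n IH] using lt_wf_ind. intros Hn.
  destruct (classic (exists k, (k < n)%nat /\ Q k)) as [(k & Hk & HQ)|H].
  - exact (IH k Hk HQ).
  - exists n. split; [exact Hn|]. intros k HQ. apply Nat.nlt_ge. intros Hk. apply H. eauto.
Qed.

Lemma leading_exists (f : ser) m :
  f m 0%nat <> RtoC 0 -> exists P, (P <= m)%nat /\ leading f P.
Proof.
  intros Hm. destruct (least_nat (fun m => f m 0%nat <> RtoC 0)) as (P & HP & Hmin); [eauto|].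
  exists P. split; [now apply Hmin|]. split; [|exact HP].
  intros i Hi. apply NNPP. intros Hc. apply Hmin in Hc. lia.
Qed.

Definition colon_b (mul : ser -> ser -> ser) (I : ser -> Prop) : ser -> Prop :=
  fun x => I (mul x ser_b).

Lemma colon_b_ideal mul I : weierstrass_mul mul -> ideal mul I -> ideal mul (colon_b mul I).
Proof.
  intros W (Hc & H0 & Ha & Hm). unfold colon_b. split; [|split; [|split]].
  - intros x Hx. apply (wm_conv_b mul W). now apply Hc.
  - apply Hm; [apply conv_ser_b|exact H0].
  - intros x y Hx Hy. rewrite wm_add_b by exact W. now apply Ha.
  - intros r x Hr Hx. destruct (wm_mul_b mul W r Hr) as (r' & Hr' & E).
    rewrite E. now apply Hm.
Qed.

Lemma colon_b_iter_ideal mul I j :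
  weierstrass_mul mul -> ideal mul I -> ideal mul (Nat.iter j (colon_b mul) I).
Proof.
  intros W HI. induction j as [|j IH]; [exact HI|]. now apply colon_b_ideal.
Qed.

Lemma colon_b_iter_mono mul (I K : ser -> Prop) j :
  (forall x, I x -> K x) ->
  forall x, Nat.iter j (colon_b mul) I x -> Nat.iter j (colon_b mul) K x.
Proof.
  intros H. induction j as [|j IH]; [exact H|]. intros x. apply IH.
Qed.

(** Each division by b leaves the lowest b-coefficient intact, so after n divisions the coefficient
    of b^n is read at b = 0, where orders are compared. *)
Lemma div_b_iter mul n K r :
  weierstrass_mul mul -> ideal mul K -> K r ->
  (forall m j, (j < n)%nat -> r m j = RtoC 0) ->
  exists x, Nat.iter n (colon_b mul) K x /\ forall m, x m 0%nat = r m n.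
Proof.
  intros W. revert K r. induction n as [|n IH]; intros K r HK Hr Hlow.
  - exists r. split; auto.
  - destruct (wm_div_b mul W r) as (r' & Hr' & E & Hsh).
    + now apply HK.
    + intros m. apply Hlow. lia.
    + assert (Hs : forall k m, (k <= n)%nat -> r' m k = r m (S k)).
      { intros k m Hk. apply Hsh. intros; apply Hlow; lia. }
      destruct (IH (colon_b mul K) r') as (x & Hx & Hx0).
      * now apply colon_b_ideal.
      * unfold colon_b. now rewrite <- E.
      * intros m j Hj. rewrite Hs by lia. apply Hlow. lia.
      * exists x. split; [now rewrite Nat.iter_succ_r|].
        intros m. now rewrite Hx0, Hs by lia.
Qed.

Lemma ser_eq0_or (r : ser) :
  r = ser0 \/ exists m n, r m n <> RtoC 0 /\ forall m' j, (j < n)%nat -> r m' j = RtoC 0.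
Proof.
  destruct (classic (exists n m, r m n <> RtoC 0)) as [H|H].
  - right. apply least_nat in H. destruct H as (n & [m Hm] & Hmin).
    exists m, n. split; [exact Hm|]. intros m' j Hj. apply NNPP. intros Hc.
    assert (n <= j)%nat; [|lia]. apply Hmin. now exists m'.
  - left. apply ser_ext; intros m n. apply NNPP. intros Hc. apply H. now exists n, m.
Qed.

Lemma ideal_divide mul K x0 P f :
  weierstrass_mul mul -> ideal mul K -> K x0 -> leading x0 P -> K f ->
  exists q r, conv q /\ K r /\ f = ser_add (mul x0 q) r /\
    forall m n, (P <= m)%nat -> r m n = RtoC 0.
Proof.
  intros W (Hc & H0 & Ha & Hm) Hx0 Hl Hf.
  destruct (wm_division mul W x0 f P) as (q & Hq & E); auto.
  exists q, (ser_add f (mul x0 (ser_scal (-1) q))).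
  split; [exact Hq|]. split; [apply Ha; [exact Hf|]; apply Hm; [now apply conv_scal|exact Hx0]|].
  rewrite wm_scal by exact W. split.
  - apply ser_ext; intros m n. unfold ser_add, ser_scal. ring.
  - intros m n HPm. unfold ser_add, ser_scal. rewrite E by exact HPm. ring.
Qed.

(** Otherwise the lowest nonzero b-coefficient of r, of degree below P in a, would appear at b = 0
    in some iterated quotient of K and have order below P there. *)
Lemma remainder_eq0 mul K P r :
  weierstrass_mul mul -> ideal mul K ->
  (forall j x P', Nat.iter j (colon_b mul) K x -> leading x P' -> (P <= P')%nat) ->
  K r -> (forall m n, (P <= m)%nat -> r m n = RtoC 0) -> r = ser0.
Proof.
  intros W HK Hmin Hr Hdeg. destruct (ser_eq0_or r) as [->|(m & n & Hmn & Hlow)]; [reflexivity|].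
  destruct (div_b_iter mul n K r W HK Hr Hlow) as (x & Hx & Hx0).
  rewrite <- Hx0 in Hmn. destruct (leading_exists x m Hmn) as (P' & HP' & Hl).
  specialize (Hmin n x P' Hx Hl). rewrite Hx0, Hdeg in Hmn by lia. now contradict Hmn.
Qed.

Lemma ideal_eq0 mul K r :
  weierstrass_mul mul -> ideal mul K ->
  (forall j x P, Nat.iter j (colon_b mul) K x -> ~ leading x P) -> K r -> r = ser0.
Proof.
  intros W HK Hno Hr. destruct (ser_eq0_or r) as [->|(m & n & Hmn & Hlow)]; [reflexivity|].
  destruct (div_b_iter mul n K r W HK Hr Hlow) as (x & Hx & Hx0).
  rewrite <- Hx0 in Hmn. destruct (leading_exists x m Hmn) as (P' & HP' & Hl).
  now destruct (Hno n x P').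
Qed.

(** * Ascending chains and normal ideals *)

Definition stabilizes (I : nat -> ser -> Prop) : Prop :=
  exists N, forall n, (N <= n)%nat -> forall x, I n x -> I N x.

Lemma chain_mono (I : nat -> ser -> Prop) :
  (forall n x, I n x -> I (S n) x) ->
  forall n n' x, (n <= n')%nat -> I n x -> I n' x.
Proof. intros H n n' x Hle Hx. induction Hle; auto. Qed.

Lemma add_ser0_r f : ser_add f ser0 = f.
Proof. apply ser_ext; intros. unfold ser_add, ser0. ring. Qed.

(** As P is least over all n and all iterated quotients, division by x0 is exact in every later
    ideal, which is therefore generated by x0. *)
Lemma stabilizes_of_minimal mul I n0 x0 P :
  weierstrass_mul mul -> (forall n, ideal mul (I n)) ->
  (forall n x, I n x -> I (S n) x) -> I n0 x0 -> leading x0 P ->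
  (forall n j x P', Nat.iter j (colon_b mul) (I n) x -> leading x P' -> (P <= P')%nat) ->
  stabilizes I.
Proof.
  intros W HI Hmon Hx0 Hl Hmin. exists n0. intros n Hn f Hf.
  destruct (ideal_divide mul (I n) x0 P f) as (q & r & Hq & Hr & E & Hdeg); auto.
  { now apply (chain_mono I Hmon n0). }
  rewrite (remainder_eq0 mul (I n) P r W (HI n) (Hmin n) Hr Hdeg), add_ser0_r in E.
  rewrite E. now apply HI.
Qed.

Lemma stabilizes_of_colon_b mul I :
  weierstrass_mul mul -> (forall n, ideal mul (I n)) ->
  (forall n x, I n x -> I (S n) x) -> stabilizes (fun n => colon_b mul (I n)) ->
  stabilizes I.
Proof.
  intros W HI Hmon [N1 HN1].
  (* An element divisible by b comes from the quotient chain, which is constant from N1 on. *)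
  assert (Hb : forall N n r, (N1 <= N <= n)%nat -> I n r -> (forall m, r m 0%nat = RtoC 0) -> I N r).
  { intros N n r HN Hr H0.
    destruct (wm_div_b mul W r) as (r' & Hr' & E & _); [now apply (HI n)|exact H0|].
    rewrite E. apply (chain_mono I Hmon N1); [lia|]. apply (HN1 n); [lia|].
    unfold colon_b. now rewrite <- E. }
  destruct (classic (exists P n x, I n x /\ leading x P)) as [H|H].
  - apply least_nat in H. destruct H as (P & (n0 & x0 & Hx0 & Hl) & Hmin).
    exists (Nat.max n0 N1). intros n Hn f Hf.
    destruct (ideal_divide mul (I n) x0 P f) as (q & r & Hq & Hr & E & Hdeg); auto.
    { apply (chain_mono I Hmon n0); [lia|exact Hx0]. }
    rewrite E. apply (HI (Nat.max n0 N1)).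
    + apply HI; [exact Hq|]. apply (chain_mono I Hmon n0); [lia|exact Hx0].
    (* At b = 0 the remainder has degree below P; were it nonzero there, its order would be below
       the least one. *)
    + apply (Hb _ n); [lia|exact Hr|]. intros m. apply NNPP. intros Hm.
      destruct (leading_exists r m Hm) as (P' & HP' & Hl').
      assert (P <= P')%nat by (apply Hmin; eauto). apply Hm, Hdeg. lia.
  - exists N1. intros n Hn f Hf. apply (Hb _ n); [lia|exact Hf|].
    intros m. apply NNPP. intros Hm.
    destruct (leading_exists f m Hm) as (P & _ & Hl). apply H. eauto.
Qed.

Lemma ideal_chain_stabilizes mul I :
  weierstrass_mul mul -> (forall n, ideal mul (I n)) ->
  (forall n x, I n x -> I (S n) x) -> stabilizes I.
Proof.
  intros W HI Hmon.
  destruct (classic (exists P j n x, Nat.iter j (colon_b mul) (I n) x /\ leading x P)) as [H|H].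
  - apply least_nat in H. destruct H as (P & (J & n0 & x0 & Hx0 & Hl) & Hmin).
    assert (Hs : stabilizes (fun n => Nat.iter J (colon_b mul) (I n))).
    { apply (stabilizes_of_minimal mul _ n0 x0 P W); auto.
      - intros n. now apply colon_b_iter_ideal.
      - intros n. apply colon_b_iter_mono, Hmon.
      (* The j-th quotient of a J-th quotient is a (j + J)-th quotient, and P is least among all of
         these. *)
      - intros n j x P' Hx HP'. apply Hmin. exists (j + J)%nat, n, x.
        now rewrite Nat.iter_add. }
    (* Descends from the J-th quotients to the ideals themselves; [Hx0] depends on J and would
       otherwise enter the induction. *)
    clear Hx0. induction J as [|J IH]; [exact Hs|]. apply IH.
    apply (stabilizes_of_colon_b mul); auto.
    + intros n. now apply colon_b_iter_ideal.
    + intros n. apply colon_b_iter_mono, Hmon.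
  - exists 0%nat. intros n _ x Hx.
    rewrite (ideal_eq0 mul (I n) x W (HI n)); [apply HI| |exact Hx].
    intros j y P Hy HP. apply H. now exists P, j, n, y.
Qed.

Lemma normal_ideal_principal mul I :
  weierstrass_mul mul -> ideal mul I -> (forall x, conv x -> I (mul x ser_b) -> I x) ->
  exists g, conv g /\ forall x, I x <-> exists y, conv y /\ x = mul g y.
Proof.
  intros W HI Hnorm.
  (* By normality the iterated quotients add nothing to I, so the least order in I is the least
     among them all. *)
  assert (Hiter : forall j x, Nat.iter j (colon_b mul) I x -> I x).
  { induction j as [|j IH]; [auto|]. intros x Hx. apply Hnorm; [|now apply IH].
    now apply (colon_b_iter_ideal mul I (S j) W HI). }
  destruct (classic (exists P x, I x /\ leading x P)) as [H|H].
  - apply least_nat in H. destruct H as (P & (g & Hg & Hl) & Hmin).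
    exists g. split; [now apply HI|]. intros f. split.
    + intros Hf. destruct (ideal_divide mul I g P f) as (q & r & Hq & Hr & E & Hdeg); auto.
      exists q. split; [exact Hq|].
      rewrite (remainder_eq0 mul I P r W HI) in E; auto.
      * now rewrite add_ser0_r in E.
      * intros j x P' Hx HP'. apply Hmin. exists x. split; [now apply (Hiter j)|exact HP'].
    + intros (y & Hy & ->). now apply HI.
  - exists ser0. split; [apply conv_ser0|]. intros f. split.
    (* Zero is written as a multiple by 0 so that [wm_scal] makes the product vanish. *)
    + intros Hf. exists (ser_scal 0 ser0). split; [apply conv_scal, conv_ser0|].
      rewrite (ideal_eq0 mul I f W HI); [| |exact Hf].
      * rewrite wm_scal by exact W. apply ser_ext; intros m n. unfold ser_scal, ser0. ring.
      * intros j x P Hx HP. apply H. exists P, x. split; [now apply (Hiter j)|exact HP].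
    + intros (y & Hy & ->). apply HI; [exact Hy|apply HI].
Qed.

Theorem theorem1p4p1 :
  left_noetherian /\ right_noetherian /\
  (forall I, left_ideal I -> normal_left I -> principal_left I) /\
  (forall I, right_ideal I -> normal_right I -> principal_right I).
Proof.
  split; [|split; [|split]].
  (* [left_ideal] is convertible to [ideal] for the opposite product, and [right_ideal] to [ideal]
     for [ser_mul]. *)
  - intros I. exact (ideal_chain_stabilizes _ I weierstrass_ser_mul_op).
  - intros I. exact (ideal_chain_stabilizes _ I weierstrass_ser_mul).
  - intros I. exact (normal_ideal_principal _ I weierstrass_ser_mul_op).
  - intros I. exact (normal_ideal_principal _ I weierstrass_ser_mul).
Qed.
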